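(* Let $t$ be an integer and let $G$ be a graph on $n$ vertices such that $3\leq \alpha(G)\leq t$. Then $$(2t-3)\,{\rm b}(G)\leq (t-2)n+(t-1)\chi(G)+(t-2)\,\Delta_t^{\sf indep}(G).$$
   Context: All graphs are finite, undirected, without loops or multiple edges. $\chi(G)$ is the chromatic number and $\alpha(G)$ the maximum size of an independent set of $G$. Let $c$ be a proper vertex coloring of $G$ using $k$ colors (every one of the $k$ colors is used). A vertex $u$ is a b-vertex (of $c$) if for each color $j\neq c(u)$, $u$ has a neighbor of color $j$. The coloring $c$ is a b-coloring if every color class contains a b-vertex. The b-chromatic number ${\rm b}(G)$ is the maximum number of colors used in a b-coloring of $G$. $\Delta_t^{\sf indep}(G)$ denotes the maximum number of pairwise vertex-disjoint independent sets of $G$, each of size $t$. *)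

(* Defs.v *)
From mathcomp Require Import all_boot.

Set Implicit Arguments.
Unset Strict Implicit.
Unset Printing Implicit Defensive.

Record sgraph := SGraph {
  vertex :> finType;
  adj : rel vertex;
  adj_sym : symmetric adj;
  adj_irrefl : irreflexive adj
}.

Section GraphParameters.
Variable G : sgraph.

Definition independent (A : {set G}) : bool :=
  [forall x in A, forall y in A, ~~ adj x y].

Definition independence_number : nat :=
  \max_(A : {set G} | independent A) #|A|.

Definition proper_coloring k (c : {ffun G -> 'I_k}) : bool :=
  [forall x, forall y, adj x y ==> (c x != c y)].

Definition all_colors_used k (c : {ffun G -> 'I_k}) : bool :=
  [forall j, exists x, c x == j].

Definition colorable k : bool := [exists c : {ffun G -> 'I_k}, proper_coloring c].

Lemma colorable_card : exists k, colorable k.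
Proof.
exists #|G|; apply/existsP; exists [ffun x => enum_rank x].
apply/forallP=> x; apply/forallP=> y; apply/implyP=> xy.
rewrite !ffunE (inj_eq enum_rank_inj).
by apply/eqP=> eq_xy; rewrite eq_xy adj_irrefl in xy.
Qed.

Definition chromatic_number : nat := ex_minn colorable_card.

Definition b_vertex k (c : {ffun G -> 'I_k}) (u : G) : bool :=
  [forall j, (j != c u) ==> [exists v, adj u v && (c v == j)]].

Definition b_coloring k (c : {ffun G -> 'I_k}) : bool :=
  [&& proper_coloring c, all_colors_used c
    & [forall j, exists u, (c u == j) && b_vertex c u]].

Definition b_colorable k : bool := [exists c : {ffun G -> 'I_k}, b_coloring c].

(* The range k <= #|G| loses nothing: see [b_colorable_card] and
   [b_chromatic_number_ge]. *)
Definition b_chromatic_number : nat := \max_(k < #|G|.+1 | b_colorable k) k.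

Lemma b_colorable_card k : b_colorable k -> k <= #|G|.
Proof.
case/existsP=> c /and3P[_ /forallP used _].
rewrite -[k]card_ord -(_ : #|[set c x | x in G]| = #|'I_k|) ?leq_imset_card //.
rewrite -cardsT; congr #|pred_of_set _|; apply/setP=> j; rewrite inE.
by have /existsP[x /eqP <-] := used j; apply: imset_f.
Qed.

Lemma b_chromatic_number_ge k : b_colorable k -> k <= b_chromatic_number.
Proof.
move=> bk; have lek := b_colorable_card bk.
by apply: (@leq_bigmax_cond _ _ (fun i : 'I_#|G|.+1 => val i)
             (Ordinal (lek : k < #|G|.+1))).
Qed.

Definition max_disjoint_independent (t : nat) : nat :=
  \max_(P : {set {set G}} |
          trivIset P && [forall A in P, independent A && (#|A| == t)]) #|P|.

End GraphParameters.

(* Main.v *)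
Require Import Defs.
From mathcomp Require Import all_boot.
From mathcomp Require Import zify.

Set Implicit Arguments.
Unset Strict Implicit.
Unset Printing Implicit Defensive.

(* Fix a b-coloring with k colors, s of whose classes are singletons, so that
   n >= 2k - s.  A b-vertex of any color is adjacent to the vertex of every
   other singleton class.  Hence in an optimal coloring the singleton classes
   take s colors that none of the k - s remaining b-vertices can use.  These
   b-vertices lie in the other chi - s classes, each of which contains at most
   t - 1 of them, except for at most Delta_t classes that contain t; so
   k - s <= (t - 1) (chi - s) + Delta_t, and the two bounds combine linearly. *)

Lemma card_independent_leq (G : sgraph) (A : {set G}) :
  independent A -> #|A| <= independence_number G.
Proof. by move=> indA; apply: (@leq_bigmax_cond _ _ (fun A : {set G} => #|A|)). Qed.

Lemma chromatic_number_coloring (G : sgraph) :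
  exists f : {ffun G -> 'I_(chromatic_number G)}, proper_coloring f.
Proof.
rewrite /chromatic_number; case: ex_minnP => m /existsP[f pf] _.
by exists f.
Qed.

Lemma proper_coloring_neq (G : sgraph) k (c : {ffun G -> 'I_k}) x y :
  proper_coloring c -> adj x y -> c x != c y.
Proof. by move=> /forallP/(_ x)/forallP/(_ y)/implyP; apply. Qed.

Lemma independent_color_class (G : sgraph) k (c : {ffun G -> 'I_k})
    (B : {set G}) q :
  proper_coloring c -> independent (B :&: [set x | c x == q]).
Proof.
move=> pc; apply/forall_inP=> x; rewrite !inE => /andP[_ /eqP cx].
apply/forall_inP=> y; rewrite !inE => /andP[_ /eqP cy].
by apply/negP=> /(proper_coloring_neq pc); rewrite cx cy eqxx.
Qed.

(** Since [0 < t], the sets [F i] are nonempty, so disjointness makes [F] injective on [D] and no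
    index is lost in the family [F @: D]. *)
Lemma card_imset_leq_max_disjoint_independent (G : sgraph) (I : finType) t
    (D : {set I}) (F : I -> {set G}) :
    0 < t ->
    (forall i, i \in D -> independent (F i) && (#|F i| == t)) ->
    {in D &, forall i j, j != i -> [disjoint F i & F j]} ->
  #|D| <= max_disjoint_independent G t.
Proof.
move=> t_gt0 indF disjF.
have F_neq0: set0 \notin F @: D.
  apply/imsetP=> -[i /indF/andP[_ /eqP cardF] F0].
  by rewrite -cardF -F0 cards0 in t_gt0.
have [trivF injF] := trivIimset disjF F_neq0.
rewrite -(card_in_imset injF) /max_disjoint_independent.
apply: (@leq_bigmax_cond _ _ (fun P : {set {set G}} => #|P|)).
rewrite trivF; apply/forall_inP=> _ /imsetP[i Di ->].
exact: indF.
Qed.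

Lemma card_leq_coloring_max_disjoint (G : sgraph) t k (f : {ffun G -> 'I_k})
    (B : {set G}) (Q : {set 'I_k}) :
    0 < t -> independence_number G <= t -> proper_coloring f ->
    {in B, forall x, f x \in Q} ->
  #|B| <= t.-1 * #|Q| + max_disjoint_independent G t.
Proof.
move=> t_gt0 alpha_le pf fB.
pose A q := B :&: [set x | f x == q].
have indA q : independent (A q) by apply: independent_color_class.
pose D := [set q in Q | #|A q| == t].
have leD : #|D| <= max_disjoint_independent G t.
  apply: (card_imset_leq_max_disjoint_independent (F := A)) => //.
    by move=> q; rewrite inE indA => /andP[].
  move=> p q _ _; apply: contraNT => /pred0Pn[x /=].
  by rewrite !inE => /andP[/andP[_ /eqP <-] /andP[_ /eqP <-]].
apply: leq_trans (leq_add (leqnn _) leD).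
have -> : #|B| = \sum_(q in Q) #|A q|.
  rewrite -sum1_card (partition_big f (mem Q)) //=.
  apply: eq_bigr => q _; rewrite -sum1_card.
  by apply: eq_bigl => x; rewrite !inE.
have -> : #|D| = \sum_(q in Q) (#|A q| == t).
  rewrite -sum1_card big_mkcond [RHS]big_mkcond; apply: eq_bigr => q _.
  by rewrite inE; case: (q \in Q); case: eqP.
(* Termwise, [#|A q| <= t.-1 + (#|A q| == t)] because [#|A q| <= t]. *)
rewrite mulnC -sum_nat_const -big_split /=; apply: leq_sum => q _.
have := leq_trans (card_independent_leq (indA q)) alpha_le.
by rewrite leq_eqVlt; case: eqP => /= [->|_]; lia.
Qed.

Section BColoring.
Variables (G : sgraph) (k : nat) (c : {ffun G -> 'I_k}).

Definition singleton_colors : {set 'I_k} :=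
  [set j | #|[set x | c x == j]| == 1].

(** Every class is nonempty, so its size plus 1 if it is a singleton is at least 2; sum over the
    colors. *)
Lemma double_colors_leq :
  all_colors_used c -> 2 * k <= #|G| + #|singleton_colors|.
Proof.
move=> /forallP used.
have -> : #|G| = \sum_j #|[set x | c x == j]|.
  rewrite -sum1_card (partition_big c predT) //=.
  by apply: eq_bigr => j _; rewrite -sum1_card; apply: eq_bigl => x; rewrite inE.
have -> : #|singleton_colors| = \sum_j (#|[set x | c x == j]| == 1).
  rewrite -sum1_card big_mkcond; apply: eq_bigr => j _.
  by rewrite inE; case: eqP.
rewrite mulnC -[k in k * 2]card_ord -sum_nat_const -big_split /=.
apply: leq_sum => j _.
have /existsP[x cx] := used j.
have : 0 < #|[set x | c x == j]| by apply/card_gt0P; exists x; rewrite inE.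
by case: eqP; lia.
Qed.

(** The neighbor of color [c y] that the b-vertex [x] must have can only be [y]. *)
Lemma b_vertex_adj_singleton x y :
    b_vertex c x -> c y \in singleton_colors -> c x != c y ->
  adj x y.
Proof.
move=> /forallP/(_ (c y))/implyP bx + neq_c.
rewrite eq_sym in neq_c.
have /existsP[v /andP[xv cv]] := bx neq_c.
rewrite inE => /cards1P[z class_z].
have /set1P-> : y \in [set z] by rewrite -class_z inE.
by have /set1P<- : v \in [set z] by rewrite -class_z inE.
Qed.

(** Here [r] stands for chi - s; the equation avoids truncated subtraction and records s <= chi. *)
Lemma b_coloring_excess_leq t :
    0 < t -> independence_number G <= t -> b_coloring c ->
  exists2 r, #|singleton_colors| + r = chromatic_number G
    & k <= #|singleton_colors| + t.-1 * r + max_disjoint_independent G t.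
Proof.
move=> t_gt0 alpha_le /and3P[pc _ /forallP has_b].
have [f pf] := chromatic_number_coloring G.
have bP j : exists u, (c u == j) && b_vertex c u by apply/existsP.
pose u j := xchoose (bP j).
have cu j : c (u j) = j by have /andP[/eqP] := xchooseP (bP j).
have bu j : b_vertex c (u j) by have /andP[] := xchooseP (bP j).
have u_inj : injective u by apply: can_inj cu.
set S := singleton_colors.
have fuS i j : j \in S -> i != j -> f (u i) != f (u j).
  move=> Sj neq_ij; apply: (proper_coloring_neq pf).
  by apply: b_vertex_adj_singleton => //; rewrite !cu.
have fu_inj : {in S &, injective (f \o u)}.
  by move=> i j _ Sj /= /eqP; apply: contraTeq => /(fuS _ _ Sj).
(* [T] holds the s distinct colors that [f] gives to the chosen b-vertices of the singleton classes;
   [r] counts the other colors of [f]. *)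
pose T := [set (f \o u) j | j in S].
exists #|~: T|; first by rewrite -(card_in_imset fu_inj) cardsC card_ord.
have fB : {in u @: ~: S, forall x, f x \in ~: T}.
  move=> _ /imsetP[i + ->]; rewrite !in_setC.
  apply: contra => /imsetP[j Sj /= /eqP].
  by apply: contraTT => nSi; apply: fuS => //; apply: contraNneq nSi => ->.
have := card_leq_coloring_max_disjoint t_gt0 alpha_le pf fB.
by rewrite (card_imset _ u_inj) -addnA -(leq_add2l #|S|) cardsC card_ord.
Qed.

End BColoring.

Theorem proposition5 (t n : nat) (G : sgraph) (cardG : #|G| = n)
    (alpha_ge3 : 3 <= independence_number G)
    (alpha_le : independence_number G <= t) :
  (2 * t - 3) * b_chromatic_number G <=
    (t - 2) * n + (t - 1) * chromatic_number G
      + (t - 2) * max_disjoint_independent G t.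
Proof.
have t_ge3 := leq_trans alpha_ge3 alpha_le.
rewrite /b_chromatic_number.
(* It suffices to bound each [k] that admits a b-coloring. *)
elim/big_rec: _ => [|[k /= _] m /existsP[c bc] IHm]; first by rewrite muln0.
rewrite maxnMr geq_max {}IHm andbT.
have t_gt0 : 0 < t by apply: leq_trans t_ge3.
have [r <-] := b_coloring_excess_leq t_gt0 alpha_le bc.
have /and3P[_ /double_colors_leq + _] := bc; rewrite cardG.
(* Replacing [t] by [t.+3] makes all the subtractions exact. *)
case: t t_ge3 {alpha_le t_gt0} => [|[|[|t]]] // _.
move: (max_disjoint_independent _ _) #|_| => d s le_n le_k.
have -> : 2 * t.+3 - 3 = 2 * t.+1 + 1 by lia.
have -> : t.+3 - 2 = t.+1 by lia.
have -> : t.+3 - 1 = t.+2 by lia.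
(* In the original t: t - 2 times [le_n] plus [le_k] gives (2t - 3)k <= (t - 2)n + (t - 1)(s + r) +
   d, and d <= (t - 2)d as t >= 3. *)
have := leq_mul (leqnn t.+1) le_n.
have : d <= t.+1 * d by rewrite leq_pmull.
move: le_k => /=; nia.
Qed.
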